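(* There exists a resource contribution game $G$ with endowments as bags of atomic resources (RCGBAR) that admits no pure Nash equilibrium in presence of private contention-averse preferences, i.e. $\mathsf{NE}^{\mathsf{ppca}}(G)=\emptyset$.
   Context: Resources. Let $Res$ be a set of atomic resource types (which may be chosen freely). A resource bundle is a finite multiset over $Res$; $A_1\bullet\cdots\bullet A_k$ is the bundle consisting of the instances $A_1,\dots,A_k$, and $B\bullet B'$ is the multiset sum of bundles $B,B'$. For a bundle $B$, $\flat(B)$ is its multiset of atomic resource instances. A resource bag is a finite multiset of resource bundles; for a bag $X=\{B_1,\dots,B_k\}$, $\flat^\bullet(X)=\flat(B_1)\uplus\dots\uplus\flat(B_k)$ (multiset sum). A bag $X$ can be transformed into a bundle $B$, written $X\rightsquigarrow B$, iff $\flat(B)\subseteq\flat^\bullet(X)$ (multiset inclusion). For bundles $B,B'$, $B_{\mid B'}$ is the bundle in which each atomic resource $x$ has the multiplicity it has in $B$ if $x$ occurs in $B'$, and multiplicity $0$ otherwise. Games. A resource contribution game (RCG) is $G=(N,\gamma_1,\dots,\gamma_n,\epsilon_1,\dots,\epsilon_n)$ with $N=\{1,\dots,n\}$ a finite set of players, $\gamma_i$ a resource bundle (goal of $i$), $\epsilon_i$ a finite resource bag (endowment of $i$). It is an RCGBAR iff for every $i\in N$ every element of $\epsilon_i$ is an atomic resource (a bundle consisting of a single instance of an element of $Res$). The choices of $i$ are $\mathsf{ch}_i(G)=\{C\mid C\subseteq\epsilon_i\}$ (sub-multisets), the profiles are $\mathsf{ch}(G)=\prod_{i\in N}\mathsf{ch}_i(G)$,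 and the outcome of $P=(P_1,\dots,P_n)$ is the bag $\mathsf{out}(P)=P_1\uplus\dots\uplus P_n$. $(P_{-i},P_i')$ is $P$ with $P_i$ replaced by $P'_i$. Satisfaction and contention. Player $i$ is potentially satisfied in $P$ iff $\mathsf{out}(P)\rightsquigarrow\gamma_i$. Let $\{s_1,\dots,s_k\}$ be the set of players potentially satisfied in $P$. $P$ is contentious for $i$ iff $i$ is potentially satisfied in $P$ and $\mathsf{out}(P)\not\rightsquigarrow{\gamma_{s_1}}_{\mid\gamma_i}\bullet\dots\bullet{\gamma_{s_k}}_{\mid\gamma_i}$. Preferences. $P$ is good for $i$ according to $\mathsf{ppca}$ (private contention-averse) iff $i$ is potentially satisfied in $P$ and $P$ is not contentious for $i$. Player $i$ strictly prefers $P$ over $Q$ (written $Q\prec_i^{\mathsf{ppca}}P$) iff one of: (1) neither $P$ nor $Q$ is good for $i$ and $P_i\subset Q_i$ (strict multiset inclusion); (2) $P$ is good for $i$ and $Q$ is not; (3) both are good for $i$ and $P_i\subset Q_i$. $P$ is a (pure) Nash equilibrium according to $\mathsf{ppca}$ iff there are no $i\in N$ and $P'_i\in\mathsf{ch}_i(G)$ with $P\prec_i^{\mathsf{ppca}}(P_{-i},P'_i)$; $\mathsf{NE}^{\mathsf{ppca}}(G)$ is the set of these. *)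

(* Defs.v *)
From mathcomp Require Import all_boot finmap multiset.

Set Implicit Arguments.
Unset Strict Implicit.
Unset Printing Implicit Defensive.

Local Open Scope mset_scope.

Definition bundle (Res : choiceType) := {mset Res}.
Definition bag (Res : choiceType) := {mset (bundle Res)}.

Section Resources.
Context {Res : choiceType}.
Implicit Types (B : bundle Res) (X : bag Res).

(* [enum_mset X] repeats each bundle according to its multiplicity in [X], so
   this is the multiset sum over all instances of bundles in [X]. *)
Definition flatten_bag X : bundle Res := \big[msetD/mset0]_(B <- enum_mset X) B.

Definition transforms X B : bool := B `<=` flatten_bag X.

Definition restrict B B' : bundle Res :=
  [fsfun x in finsupp B => if x \in B' then B x else 0].

Lemma flatten_bagE X x : flatten_bag X x = \sum_(B <- enum_mset X) B x.
Proof.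
by apply: (big_morph (fun B : {mset Res} => B x)) => [B B'|]; rewrite ?msetE2 ?mset0E.
Qed.

Lemma restrictE B B' x : restrict B B' x = if x \in B' then B x else 0.
Proof.
by rewrite fsfunE; case: finsuppP => // _; rewrite if_same.
Qed.

End Resources.

Record rcg (Res : choiceType) := Rcg {
  nplayers : nat;
  goal : 'I_nplayers -> bundle Res;
  endowment : 'I_nplayers -> bag Res
}.

Section Games.
Context {Res : choiceType} (G : rcg Res).

Definition player := 'I_(nplayers G).

Definition is_rcgbar : Prop :=
  forall (i : player) (B : bundle Res), B \in endowment i ->
    exists x : Res, B = [mset x].

Definition choice_of (i : player) (C : bag Res) : bool := C `<=` endowment i.

(* Membership of the contributions in the endowments is required separately,
   by [is_profile]. *)
Definition profile := {ffun player -> bag Res}.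

Implicit Types (P Q : profile) (i : player).

Definition is_profile P : Prop := forall i, choice_of i (P i).

Definition outcome P : bag Res := \big[msetD/mset0]_(i : player) P i.

Definition deviate P i (C : bag Res) : profile :=
  [ffun j => if j == i then C else P j].

Definition pot_satisfied P i : bool := transforms (outcome P) (goal i).

Definition contentious P i : bool :=
  pot_satisfied P i &&
  ~~ transforms (outcome P)
       (\big[msetD/mset0]_(s : player | pot_satisfied P s)
           restrict (goal s) (goal i)).

Definition good_ppca P i : bool := pot_satisfied P i && ~~ contentious P i.

(* [prefers_ppca i Q P]: player [i] strictly prefers [P] over [Q]. *)
Definition prefers_ppca i Q P : Prop :=
  [\/ [/\ ~~ good_ppca P i, ~~ good_ppca Q i & P i `<` Q i],
      good_ppca P i /\ ~~ good_ppca Q i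
    | [/\ good_ppca P i, good_ppca Q i & P i `<` Q i]].

Definition NE_ppca P : Prop :=
  is_profile P /\
  ~ exists (i : player) (C : bag Res),
      choice_of i C /\ prefers_ppca i P (deviate P i C).

End Games.

(* Main.v *)
Require Import Defs.
From mathcomp Require Import all_boot finmap multiset.

(** The game has two resource types, [true] and [false], and four players with
   goals [{t}], [{f}], [{t,f}] and [{t,f,f}].  Only the first two players own
   anything, two instances of [t] and four of [f], so that a profile is a pair
   [(a, x)] of numbers of contributed instances.  The other two players create
   contention on [t] and [f] once enough has been contributed: the first player
   is best off with [a = 1] if [x = 0], [a = 2] if [x = 1] and [a = 0] if
   [x >= 2], while the second one is best off with [x = 1] if [a = 0] and
   [x = 4] if [a > 0].  No pair is stable under these best responses. *)

Set Implicit Arguments.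
Unset Strict Implicit.
Unset Printing Implicit Defensive.

Local Open Scope mset_scope.

Section Multisets.
Context {K : choiceType}.
Implicit Types (A B : {mset K}) (x : K).

Lemma perm_enum_msetD A B :
  perm_eq (enum_mset (A `+` B)) (enum_mset A ++ enum_mset B).
Proof. by apply/allP => x _ /=; rewrite count_cat !count_mem_mset msetE2. Qed.

(** This turns a choice from an endowment of identical copies into a single number. *)
Lemma msub_msetn n x A : A `<=` msetn n x -> A = msetn (A x) x.
Proof.
move=> /msubsetP sAx; apply/msetP => y; rewrite msetnE.
by case: eqP => [-> // | /eqP/negbTE yx]; have := sAx y; rewrite msetnE yx leqn0 => /eqP.
Qed.

Lemma msetn_sub m n x : (msetn m x `<=` msetn n x) = (m <= n).
Proof.
apply/msubsetP/idP => [/(_ x) | lemn y]; first by rewrite !msetnxx.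
by rewrite !msetnE; case: eqP.
Qed.

Lemma msetn_proper m n x : (msetn m x `<` msetn n x) = (m < n).
Proof. by rewrite mproperE !msetn_sub -ltnNge andb_idl // => /ltnW. Qed.

Lemma msubset_boolE (A B : {mset bool}) :
  (A `<=` B) = (A true <= B true) && (A false <= B false).
Proof. by apply/msubsetP/andP => [sAB | [? ?] []]. Qed.

Lemma big_msetDE (I : Type) (r : seq I) (P : pred I) (F : I -> {mset K}) x :
  (\big[msetD/mset0]_(i <- r | P i) F i) x = \sum_(i <- r | P i) F i x.
Proof. by apply: (big_morph (fun A => A x)) => [A B|]; rewrite ?msetE2 ?mset0E. Qed.

End Multisets.

Section FlattenBag.
Context {Res : choiceType}.
Implicit Types (B : bundle Res) (X Y : bag Res).

Lemma flatten_bagD X Y : flatten_bag (X `+` Y) = flatten_bag X `+` flatten_bag Y.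
Proof.
apply/msetP => r; rewrite msetE2 !flatten_bagE.
by rewrite (perm_big _ (perm_enum_msetD X Y)) big_cat.
Qed.

Lemma flatten_bag0 : flatten_bag mset0 = mset0 :> bundle Res.
Proof. by rewrite /flatten_bag enum_mset0 big_nil. Qed.

Lemma flatten_bag_msetn n B r : flatten_bag (msetn n B) r = n * B r.
Proof. by rewrite flatten_bagE enum_msetn big_nseq iter_addn addn0 mulnC. Qed.

Lemma flatten_outcomeE (G : rcg Res) (P : profile G) r :
  flatten_bag (outcome P) r = \sum_i flatten_bag (P i) r.
Proof.
apply: (big_morph (fun X => flatten_bag X r)) => [X Y|].
  by rewrite flatten_bagD msetE2.
by rewrite flatten_bag0 mset0E.
Qed.

End FlattenBag.

Definition owner_t : 'I_4 := @Ordinal 4 0 isT.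
Definition owner_f : 'I_4 := @Ordinal 4 1 isT.

Definition demand (i : 'I_4) (r : bool) : nat :=
  nth 0 (if r then [:: 1; 0; 1; 1] else [:: 0; 1; 1; 2]) i.

Definition cycling_goal (i : 'I_4) : bundle bool :=
  msetn (demand i true) true `+` msetn (demand i false) false.

(** The same formula describes endowments, at [(2, 4)], and the choices in a profile. *)
Definition contribution (a x : nat) (i : 'I_4) : bag bool :=
  if i == 0 :> nat then msetn a [mset true]
  else if i == 1 :> nat then msetn x [mset false] else mset0.

Definition cycling_game : rcg bool := Rcg cycling_goal (contribution 2 4).

Definition cycling_profile (a x : nat) : profile cycling_game := [ffun i => contribution a x i].

Lemma cycling_goalE i r : cycling_goal i r = demand i r.
Proof. by rewrite msetE2 !msetnE; case: r; rewrite /= ?addn0. Qed.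

Lemma cycling_game_rcgbar : is_rcgbar cycling_game.
Proof.
move=> i B; rewrite /= /contribution; case: ifP => _; last case: ifP => _.
- by rewrite in_msetn => /eqP ->; exists true.
- by rewrite in_msetn => /eqP ->; exists false.
- by rewrite in_mset0.
Qed.

(** Each owner holds copies of one bundle, so the multiplicity of that bundle determines its choice;
    the other two players can only choose [mset0]. *)
Lemma cycling_profile_surj (P : profile cycling_game) :
  is_profile P -> exists a x, [/\ a <= 2, x <= 4 & P = cycling_profile a x].
Proof.
move=> profP.
have := profP owner_t; have := profP owner_f.
rewrite /choice_of /= /contribution /= => sP1 sP0.
exists (P owner_t [mset true]), (P owner_f [mset false]).
split.
- by have /msubsetP/(_ [mset true]) := sP0; rewrite msetnxx.
- by have /msubsetP/(_ [mset false]) := sP1; rewrite msetnxx.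
apply/ffunP => i; rewrite ffunE /contribution.
case: eqP => [i0 | /eqP/negbTE n0].
  by rewrite (_ : i = owner_t); [exact: msub_msetn sP0 | exact: val_inj].
case: eqP => [i1 | /eqP/negbTE n1].
  by rewrite (_ : i = owner_f); [exact: msub_msetn sP1 | exact: val_inj].
by have := profP i; rewrite /choice_of /= /contribution n0 n1 msubset0 => /eqP.
Qed.

(** The lists stop after the two owners: the default [0] of [nth] is the contribution of the other
    players. *)
Lemma flatten_contribution a x i r :
  flatten_bag (contribution a x i) r = nth 0 (if r then [:: a; 0] else [:: 0; x]) i.
Proof.
rewrite /contribution; case: i => [[|[|i]] ilt4] /=.
- by rewrite flatten_bag_msetn msetnE; case: r; rewrite ?muln1 ?muln0.
- by rewrite flatten_bag_msetn msetnE; case: r; rewrite ?muln1 ?muln0.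
by rewrite flatten_bag0 mset0E; case: r; rewrite /= nth_nil.
Qed.

Lemma flatten_outcome a x r :
  flatten_bag (outcome (cycling_profile a x)) r = if r then a else x.
Proof.
rewrite flatten_outcomeE.
under eq_bigr => i _ do rewrite ffunE flatten_contribution.
rewrite (big_ord_recl 3) 3!big_ord_recl big_ord0 /=.
by case: r; rewrite /= ?addn0.
Qed.

Definition cycling_satisfied a x i := (demand i true <= a) && (demand i false <= x).

Lemma pot_satisfied_cycling a x i :
  pot_satisfied (cycling_profile a x) i = cycling_satisfied a x i.
Proof.
by rewrite /pot_satisfied /transforms msubset_boolE !flatten_outcome !cycling_goalE.
Qed.

(** Over [bool], inclusion of bundles is a pair of inequalities, one per resource. The test
    [0 < demand i r] encodes the restriction to the goal of [i]. *)
Lemma good_cycling a x i :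
  good_ppca (cycling_profile a x) i =
  let total r := \sum_(s < 4 | cycling_satisfied a x s)
                   (if 0 < demand i r then demand s r else 0) in
  [&& cycling_satisfied a x i, total true <= a & total false <= x].
Proof.
have totalE r :
  (\big[msetD/mset0]_(s | pot_satisfied (cycling_profile a x) s)
      restrict (goal s) (goal i)) r =
  \sum_(s < 4 | cycling_satisfied a x s) (if 0 < demand i r then demand s r else 0).
  rewrite big_msetDE; apply: eq_big => s; first exact: pot_satisfied_cycling.
  by move=> _; rewrite restrictE in_mset /= !cycling_goalE.
rewrite /good_ppca /contentious pot_satisfied_cycling /transforms.
rewrite msubset_boolE !totalE !flatten_outcome /=.
by case: cycling_satisfied; rewrite //= negbK.
Qed.

(** The summands are the claims on [t] of the goals [{t}], [{t,f}] and [{t,f,f}], the last two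
    arising at [x = 1] and [x = 2]. For [x >= 2] they exceed the two instances owned. *)
Definition good_t a x := (0 < a) && (1 + (0 < x) + (1 < x) <= a).

(** The goal [{t,f,f}] claims two instances of [f], hence the doubling. If [a > 0], the claims are 2
    at [x = 1] and 4 from [x = 2] on, so within the endowment only [x = 4] is good. *)
Definition good_f a x := (0 < x) && (1 + (0 < a) + ((0 < a) && (1 < x)).*2 <= x).

Lemma good_owner_t a x : good_ppca (cycling_profile a x) owner_t = good_t a x.
Proof.
rewrite good_cycling /= !(big_mkcond (cycling_satisfied _ _)) /=.
rewrite !big_ord_recl !big_ord0 /cycling_satisfied /=.
(* Goals ask for at most one [t] and two [f], so these cases decide who is satisfied. *)
by case: a => [|a]; case: x => [|[|x]]; rewrite // /demand /= ?andbT.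
Qed.

Lemma good_owner_f a x : good_ppca (cycling_profile a x) owner_f = good_f a x.
Proof.
rewrite good_cycling /= !(big_mkcond (cycling_satisfied _ _)) /=.
rewrite !big_ord_recl !big_ord0 /cycling_satisfied /=.
by case: a => [|a]; case: x => [|[|x]].
Qed.

(* [g k] stands for the profile being good when the player contributes [k]
   instances of its resource. *)
Definition better (g : nat -> bool) m n := if g m == g n then n < m else g n.

(** When goodness agrees, the first and third clauses of the preference both ask for strict
    inclusion, which for copies of one bundle is [<] on their numbers. *)
Lemma prefers_better (P Q : profile cycling_game) i (g : nat -> bool) m n (B : bundle bool) :
  P i = msetn m B -> Q i = msetn n B ->
  good_ppca P i = g m -> good_ppca Q i = g n ->
  better g m n -> prefers_ppca i P Q.
Proof.
rewrite /prefers_ppca /better => -> -> -> ->; rewrite msetn_proper.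
by case: (g m) (g n) => [] [] //= ltnm;
  [constructor 3 | constructor 2 | constructor 1].
Qed.

Lemma deviate_owner_t a x b :
  deviate (cycling_profile a x) owner_t (msetn b [mset true]) = cycling_profile b x.
Proof.
apply/ffunP => i; rewrite !ffunE; case: eqP => [-> // | /eqP/negbTE].
by rewrite -val_eqE /contribution /= => ->.
Qed.

Lemma deviate_owner_f a x y :
  deviate (cycling_profile a x) owner_f (msetn y [mset false]) = cycling_profile a y.
Proof.
apply/ffunP => i; rewrite !ffunE; case: eqP => [-> // | /eqP/negbTE].
by rewrite -val_eqE /contribution /= => ->.
Qed.

Lemma NE_owner_t a x b :
  NE_ppca (cycling_profile a x) -> b <= 2 -> ~~ better (good_t ^~ x) a b.
Proof.
case=> _ noDev leb; apply/negP => betterb; apply: noDev.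
exists owner_t, (msetn b [mset true]); rewrite /choice_of msetn_sub; split=> //.
rewrite deviate_owner_t; move: betterb.
by apply: prefers_better; rewrite ?good_owner_t ?ffunE.
Qed.

Lemma NE_owner_f a x y :
  NE_ppca (cycling_profile a x) -> y <= 4 -> ~~ better (good_f a) x y.
Proof.
case=> _ noDev ley; apply/negP => bettery; apply: noDev.
exists owner_f, (msetn y [mset false]); rewrite /choice_of msetn_sub; split=> //.
rewrite deviate_owner_f; move: bettery.
by apply: prefers_better; rewrite ?good_owner_f ?ffunE.
Qed.

Theorem proposition6 :
  exists (Res : choiceType) (G : rcg Res),
    is_rcgbar G /\ ~ (exists P : profile G, NE_ppca P).
Proof.
exists bool, cycling_game; split; first exact: cycling_game_rcgbar.
case=> P neP; have [a [x [lea lex defP]]] := cycling_profile_surj neP.1.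
rewrite {}defP in neP.
(* Both owners are tested against their best responses only. *)
have := NE_owner_t (b := if x is x'.+1 then if x' is 0 then 2 else 0 else 1) neP.
have := NE_owner_f (y := if a is 0 then 1 else 4) neP.
(* In each of the fifteen pairs at least one owner strictly gains. Alternating responses run through
   the cycle [(0,1)], [(2,1)], [(2,4)], [(0,4)], [(0,1)]. *)
by case: a x lea lex {neP} => [|[|[|a]]] [|[|[|[|[|x]]]]] // _ _ /(_ isT) nf /(_ isT).
Qed.
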